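(* Let $(\mathfrak g,\nu,\alpha)$ be a Hom-Lie algebra over a field $\mathbb K$ of characteristic zero and let $(\mathfrak g[[t]],\nu_t,\alpha_t)$, $\nu_t=\nu+\sum_{i\ge1}\nu_it^i$, $\alpha_t=\alpha+\sum_{i\ge1}\alpha_it^i$, be a deformation of $\mathfrak g$ (write $\nu_0=\nu$, $\alpha_0=\alpha$). Then: 1. The first order term is a 2-cocycle of the $\alpha$-type Chevalley–Eilenberg complex, i.e. $\partial(\nu_1,\alpha_1)=0$, and its cohomology class in $\widetilde H^2(\mathfrak g,\mathfrak g)$ is invariant under equivalence of deformations. 2. For each $n\ge1$, the $n$-th deformation equations with respect to the Hom-Jacobi identity and multiplicativity, namely $$\sum_{i+j+k=n}\ \sum_{\mathrm{cyc}(x,y,z)}\nu_i(\alpha_j(x),\nu_k(y,z))=0,\qquad \sum_{i=0}^n\alpha_i(\nu_{n-i}(x,y))-\sum_{i+j+k=n}\nu_i(\alpha_j(x),\alpha_k(y))=0$$ for all $x,y,z\in\mathfrak g$ (indices $i,j,k\ge0$), are equivalent to $\partial(\nu_n,\alpha_n)=(R^1_n,R^2_n)$, where $$R^1_n(x,y,z)=-\sum_{\substack{0\le i,j,k\le n-1\\ i+j+k=n}}\ \sum_{\mathrm{cyc}(x,y,z)}\nu_i(\alpha_j(x),\nu_k(y,z)),$$ $$R^2_n(x,y)=-\sum_{i=1}^{n-1}\alpha_i(\nu_{n-i}(x,y))+\sum_{\substack{0\le i,j,k\le n-1\\ i+j+k=n}}\nu_i(\alpha_j(x),\alpha_k(y)).$$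 Furthermore, $(R^1_n,R^2_n)$ is a 3-cocycle, i.e. $\partial(R^1_n,R^2_n)=0$.
   Context: A Hom-Lie algebra $(\mathfrak g,\nu,\alpha)$ is a vector space (or module) with a linear map $\alpha$ and a skew-symmetric bilinear bracket $\nu(x\otimes y)=[x,y]$ with $[[x,y],\alpha(z)]+[[y,z],\alpha(x)]+[[z,x],\alpha(y)]=0$ and $\alpha([x,y])=[\alpha(x),\alpha(y)]$. A (one-parameter formal) deformation of $(\mathfrak g,\nu,\alpha)$ is a Hom-Lie algebra $(\mathfrak g[[t]],\nu_t,\alpha_t)$ over $\mathbb K[[t]]$ with $\nu_t=\nu+\sum_{i\ge1}\nu_it^i$, $\alpha_t=\alpha+\sum_{i\ge1}\alpha_it^i$, where $\nu_i:\mathfrak g\otimes\mathfrak g\to\mathfrak g$ (skew-symmetric) and $\alpha_i:\mathfrak g\to\mathfrak g$ are $\mathbb K$-linear, extended $\mathbb K[[t]]$-linearly. Two deformations $(\nu_t,\alpha_t)$ and $(\nu'_t,\alpha'_t)$ are equivalent if there is $S=\mathrm{id}+\sum_{i\ge1}S_it^i$ with linear $S_i:\mathfrak g\to\mathfrak g$ such that $S(\nu'_t(x,y))=\nu_t(S(x),S(y))$ and $S\alpha'_t=\alpha_tS$. $\sum_{\mathrm{cyc}(x,y,z)}$ denotes the cyclic sum over $x,y,z$. The $\alpha$-type Chevalley–Eilenberg complex is $\widetilde C^n(\mathfrak g)=\mathrm{Hom}(\Lambda^n\mathfrak g,\mathfrak g)\oplus\mathrm{Hom}(\Lambda^{n-1}\mathfrak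 g,\mathfrak g)\ni(\varphi,\psi)$, where $\mathrm{Hom}(\Lambda^k\mathfrak g,\mathfrak g)$ is set to $0$ for $k\le0$, with differential $\partial(\varphi,\psi)=(\partial_{\nu\nu}\varphi-\partial_{\alpha\nu}\psi,\ \partial_{\nu\alpha}\varphi-\partial_{\alpha\alpha}\psi)$, where (hats denote omission) $$(\partial_{\nu\nu}\varphi)(x_1,\dots,x_{n+1})=\sum_{i}(-1)^{i+1}[\alpha^{n-1}(x_i),\varphi(\dots,\widehat{x_i},\dots)]-\sum_{i<j}(-1)^{i+j-1}\varphi([x_i,x_j],\alpha(x_1),\dots,\widehat{x_i},\dots,\widehat{x_j},\dots,\alpha(x_{n+1})),$$ $$(\partial_{\alpha\alpha}\psi)(x_1,\dots,x_n)=\sum_{i}(-1)^{i+1}[\alpha^{n-1}(x_i),\psi(\dots,\widehat{x_i},\dots)]-\sum_{i<j}(-1)^{i+j-1}\psi([x_i,x_j],\alpha(x_1),\dots,\widehat{x_i},\dots,\widehat{x_j},\dots,\alpha(x_n)),$$ $$(\partial_{\nu\alpha}\varphi)(x_1,\dots,x_n)=\alpha(\varphi(x_1,\dots,x_n))-\varphi(\alpha(x_1),\dots,\alpha(x_n)),$$ $$(\partial_{\alpha\nu}\psi)(x_1,\dots,x_{n+1})=\sum_{i<j}(-1)^{i+j-1}[[\alpha^{n-2}(x_i),\alpha^{n-2}(x_j)],\psi(\dots,\widehat{x_i},\dots,\widehat{x_j},\dots)].$$ Its cohomology is denoted $\widetilde H^\bullet(\mathfrak g,\mathfrak g)$. 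*)

(* Defs.v *)
From HB Require Import structures.
From mathcomp Require Import all_boot all_order all_algebra sesquilinear.
From mathcomp Require Import boolp classical_sets functions.

Set Implicit Arguments.
Unset Strict Implicit.
Unset Printing Implicit Defensive.

Import GRing.Theory.
Local Open Scope ring_scope.

(* V[[t]]: the series \sum_i v_i t^i is the function i |-> v_i.  Addition is
   coefficientwise; the product and the scaling below are Cauchy products, and
   not the pointwise operations carried by the function type nat -> V. *)
Definition fps (V : Type) : Type := nat -> V.

HB.instance Definition _ (V : zmodType) :=
  GRing.Zmodule.copy (fps V) (nat -> V).

Lemma fps_addE (V : zmodType) (u v : fps V) n : (u + v) n = u n + v n.
Proof. by []. Qed.

Section FpsRing.
Variable K : comNzRingType.

Definition fps_one : fps K := fun n => (n == 0%N)%:R.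

Definition fps_mul (a b : fps K) : fps K :=
  fun n => \sum_(i < n.+1) a i * b (n - i)%N.

Definition fps_scale (V : lmodType K) (a : fps K) (v : fps V) : fps V :=
  fun n => \sum_(i < n.+1) a i *: v (n - i)%N.

Lemma fps_scaleA (V : lmodType K) (a b : fps K) (v : fps V) :
  fps_scale a (fps_scale b v) = fps_scale (fps_mul a b) v.
Proof.
apply/funext => n; rewrite /fps_scale /fps_mul.
pose F (i j : nat) := a i *: (b j *: v (n - i - j)%N).
transitivity (\sum_(i < n.+1) \sum_(j < n.+1 | (j <= n - i)%N) F i j).
  apply: eq_bigr => /= i _; rewrite scaler_sumr.
  by rewrite (big_ord_narrow_leq (leq_subr _ _)).
transitivity (\sum_(k < n.+1) \sum_(i < n.+1 | (i <= k)%N) F i (k - i)%N).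
  rewrite [RHS](exchange_big_dep predT) //=; apply: eq_bigr => i _.
  have lei : (i <= n)%N by rewrite -ltnS.
  rewrite -(big_geq_mkord i n.+1 xpredT (fun k => F i (k - i)%N)).
  rewrite -[in RHS](add0n (i : nat)) big_addn subSn //.
  under [in RHS]eq_bigr => j _ do rewrite addnK.
  by rewrite (big_ord_narrow_leq (leq_subr _ _)) /= big_mkord.
apply: eq_bigr => k _; rewrite scaler_suml.
rewrite (big_ord_narrow_leq (ltn_ord k : (k <= n)%N)) /=.
apply: eq_bigr => i _; rewrite /F scalerA /=; congr (_ *: v _).
by rewrite -subnDA subnKC // -ltnS.
Qed.

Lemma fps_scale1 (V : lmodType K) : left_id fps_one (@fps_scale V).
Proof.
move=> v; apply/funext => n; rewrite /fps_scale big_ord_recl /= scale1r subn0.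
by rewrite big1 ?addr0 // => i _; rewrite /fps_one /= scale0r.
Qed.

Lemma fps_scaleDr (V : lmodType K) : right_distributive (@fps_scale V) +%R.
Proof.
move=> a u v; apply/funext => n; rewrite fps_addE /fps_scale -big_split /=.
by apply: eq_bigr => i _; rewrite fps_addE scalerDr.
Qed.

Lemma fps_scaleDl (V : lmodType K) (v : fps V) :
  {morph (@fps_scale V)^~ v : a b / a + b}.
Proof.
move=> a b; apply/funext => n; rewrite fps_addE /fps_scale -big_split /=.
by apply: eq_bigr => i _; rewrite fps_addE scalerDl.
Qed.

Lemma fps_mulC : commutative fps_mul.
Proof.
move=> a b; apply/funext => n; rewrite /fps_mul (reindex_inj rev_ord_inj) /=.
by apply: eq_bigr => i _; rewrite subSS subKn 1?mulrC // -ltnS.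
Qed.

Lemma fps_mulA : associative fps_mul.
Proof. by move=> a b c; have := @fps_scaleA K^o a b c. Qed.

Lemma fps_mul1 : left_id fps_one fps_mul.
Proof. by move=> a; have := @fps_scale1 K^o a. Qed.

Lemma fps_mulDl : left_distributive fps_mul +%R.
Proof. by move=> a b c; have := @fps_scaleDl K^o c a b. Qed.

Lemma fps_one_neq0 : fps_one != 0.
Proof.
by apply/eqP => /(congr1 (fun a : fps K => a 0%N))/eqP; rewrite oner_eq0.
Qed.

HB.instance Definition _ := GRing.Zmodule_isComNzRing.Build (fps K)
  fps_mulA fps_mulC fps_mul1 fps_mulDl fps_one_neq0.

HB.instance Definition _ (V : lmodType K) :=
  GRing.Zmodule_isLmodule.Build (fps K) (fps V)
    (@fps_scaleA V) (@fps_scale1 V) (@fps_scaleDr V) (@fps_scaleDl V).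

End FpsRing.

Definition cyc (A : Type) (V : zmodType) (F : A -> A -> A -> V) (x y z : A) : V :=
  F x y z + F y z x + F z x y.

(* The sum of F i j k over 0 <= i, j, k < N with i + j + k = n. *)
Definition sum3 (V : zmodType) (N n : nat) (F : nat -> nat -> nat -> V) : V :=
  \sum_(i < N) \sum_(j < N) \sum_(k < N | (i + j + k == n)%N) F i j k.

Record hom_lie (R : comNzRingType) (M : lmodType R)
    (nu : M -> M -> M) (alpha : M -> M) : Prop := HomLie {
  hom_lie_linear : linear alpha;
  hom_lie_linearl : forall y, linear (nu^~ y);
  hom_lie_linearr : forall x, linear (nu x);
  hom_lie_skew : forall x y, nu x y = - nu y x;
  hom_lie_jacobi :
    forall x y z, cyc (fun x y z => nu (nu x y) (alpha z)) x y z = 0;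
  hom_lie_mult : forall x y, alpha (nu x y) = nu (alpha x) (alpha y)
}.

Section Deformations.
Variables (K : fieldType) (g : lmodType K).
Implicit Types (nu : g -> g -> g) (alpha : g -> g).
Implicit Types (nus : nat -> g -> g -> g) (alphas Ss : nat -> g -> g).

(* The K[[t]]-(bi)linear extensions to g[[t]] of \sum_i f_i t^i on g. *)
Definition series1 (f : nat -> g -> g) (x : fps g) : fps g :=
  fun n => \sum_(i < n.+1) f i (x (n - i)%N).

Definition series2 (f : nat -> g -> g -> g) (x y : fps g) : fps g :=
  fun n => sum3 n.+1 n (fun i j k => f i (x j) (y k)).

(* Coefficients (nu_i, alpha_i) of a candidate deformation of (nu, alpha):
   the Hom-Lie identities over K[[t]] are not required. *)
Record formal_coefs nu alpha nus alphas : Prop := FormalCoefs {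
  formal_coefs_nu0 : nus 0%N = nu;
  formal_coefs_alpha0 : alphas 0%N = alpha;
  formal_coefs_linear : forall i, linear (alphas i);
  formal_coefs_linearl : forall i y, linear ((nus i)^~ y);
  formal_coefs_linearr : forall i x, linear (nus i x);
  formal_coefs_skew : forall i x y, nus i x y = - nus i y x
}.

Definition deformation nu alpha nus alphas : Prop :=
  formal_coefs nu alpha nus alphas
  /\ @hom_lie (fps K) (fps g) (series2 nus) (series1 alphas).

Definition equivalent_deformations nus alphas nus' alphas' : Prop :=
  exists Ss, [/\ Ss 0%N = id,
    forall i, linear (Ss i),
    forall x y : fps g, series1 Ss (series2 nus' x y)
                        = series2 nus (series1 Ss x) (series1 Ss y)
  & forall x : fps g, series1 Ss (series1 alphas' x)
                      = series1 alphas (series1 Ss x)].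

Definition jacobi_equation nus alphas (n : nat) : Prop :=
  forall x y z, sum3 n.+1 n (fun i j k =>
    cyc (fun x y z => nus i (alphas j x) (nus k y z)) x y z) = 0.

Definition mult_equation nus alphas (n : nat) : Prop :=
  forall x y, \sum_(0 <= i < n.+1) alphas i (nus (n - i)%N x y)
    - sum3 n.+1 n (fun i j k => nus i (alphas j x) (alphas k y)) = 0.

Definition R1 nus alphas (n : nat) (x y z : g) : g :=
  - sum3 n n (fun i j k =>
      cyc (fun x y z => nus i (alphas j x) (nus k y z)) x y z).

Definition R2 nus alphas (n : nat) (x y : g) : g :=
  - (\sum_(1 <= i < n) alphas i (nus (n - i)%N x y))
  + sum3 n n (fun i j k => nus i (alphas j x) (alphas k y)).

End Deformations.

Section Complex.
Variables (K : fieldType) (g : lmodType K).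

Definition mfun (n : nat) : Type := ('I_n -> g) -> g.

Definition mfun1 (f : g -> g) : mfun 1 := fun x => f (x 0).
Definition mfun2 (f : g -> g -> g) : mfun 2 := fun x => f (x 0) (x 1).
Definition mfun3 (f : g -> g -> g -> g) : mfun 3 :=
  fun x => f (x 0) (x 1) (x 2).

(* Hom(Lambda^n g, g), as alternating multilinear maps, with the convention
   that it is 0 for n = 0. *)
Record alternating (n : nat) (f : mfun n) : Prop := Alternating {
  alternating_linear : forall (x : 'I_n -> g) i,
    linear (fun u => f (@dfwith _ (fun=> g) x i u));
  alternating_eq0 : forall (x : 'I_n -> g) i j, i != j -> x i = x j -> f x = 0;
  alternating_arity0 : n = 0%N -> f = fun=> 0
}.

Definition omit (n : nat) (i : 'I_n) (x : 'I_n -> g) : 'I_n.-1 -> g :=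
  fun k => x (lift i k).

(* The family (v, z_1, z_2, ...).  The index i only witnesses that 'I_n is not
   empty, so that it has an element of value 0. *)
Definition fcons (n : nat) (i : 'I_n) (v : g) (z : 'I_n.-1 -> g) : 'I_n -> g :=
  fun k => oapp z v (unlift (Ordinal (leq_ltn_trans (leq0n i) (ltn_ord i))) k).

Variables (nu : g -> g -> g) (alpha : g -> g).

(* In the double sums over i < j, omitting x_j first leaves the indices i < j
   unchanged: omit j x i is x_i, and omit i (omit j x) omits both.  Indices
   start at 0, so (-1)^(i+1) becomes (-1)^i, and (-1)^(i+j-1) becomes
   (-1)^(i+j+1). *)

(* The common shape of d_nu_nu and d_alpha_alpha, which differ only by the
   arity m of the argument for a given exponent p. *)
Definition d_ce (p m : nat) (f : mfun m) : mfun m.+1 := fun x =>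
  \sum_(i < m.+1) (-1) ^+ i *: nu (iter p alpha (x i)) (f (omit i x))
  - \sum_(j < m.+1) \sum_(i < m | (i < j)%N)
      (-1) ^+ (i + j).+1 *: f (fcons i (nu (omit j x i) (x j))
                                       (alpha \o omit i (omit j x))).

(* The components of the differential in degree n.+1, where
   phi : Hom(Lambda^n.+1 g, g) and psi : Hom(Lambda^n g, g). *)
Definition d_nu_nu (n : nat) (phi : mfun n.+1) : mfun n.+2 := d_ce n phi.

Definition d_alpha_alpha (n : nat) (psi : mfun n) : mfun n.+1 := d_ce n psi.

Definition d_nu_alpha (n : nat) (phi : mfun n.+1) : mfun n.+1 :=
  fun x => alpha (phi x) - phi (alpha \o x).

(* In degree 1 the exponent n - 2 of alpha is -1, but there psi = 0. *)
Definition d_alpha_nu (n : nat) (psi : mfun n) : mfun n.+2 := fun x =>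
  \sum_(j < n.+2) \sum_(i < n.+1 | (i < j)%N)
    (-1) ^+ (i + j).+1 *: nu (nu (iter n.-1 alpha (omit j x i))
                                 (iter n.-1 alpha (x j)))
                             (psi (omit i (omit j x))).

Definition cochain (n : nat) : Type := (mfun n * mfun n.-1)%type.

Definition cochains (n : nat) : set (cochain n) :=
  [set c | alternating c.1 /\ alternating c.2]%classic.

Arguments cochains : clear implicits.

Definition differential (n : nat) : cochain n -> cochain n.+1 :=
  match n with
  | 0 => fun=> 0
  | n.+1 => fun c => (d_nu_nu c.1 - d_alpha_nu c.2,
                      d_nu_alpha c.1 - d_alpha_alpha c.2)
  end.

Definition cocycles (n : nat) : set (cochain n) :=
  [set c | cochains n c /\ differential c = 0]%classic.

Arguments cocycles : clear implicits.

Definition coboundaries (n : nat) : set (cochain n) :=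
  match n with
  | 0 => [set 0]%classic
  | n.+1 => (@differential n @` cochains n)%classic
  end.

Arguments coboundaries : clear implicits.

(* The class of c, as a coset of the space of coboundaries. *)
Definition cohomology_class (n : nat) (c : cochain n) : set (cochain n) :=
  [set c + b | b in coboundaries n]%classic.

End Complex.

Arguments cochains {K g} n c.
Arguments cocycles {K g} nu alpha n c.
Arguments coboundaries {K g} nu alpha n c.

(* Main.v *)
(* Among the terms of the order n deformation equations, those in which some
   index equals n make up the differential of (nu_n, alpha_n), and the others
   make up -R^1_n and -R^2_n.  Hence (R^1_n, R^2_n) is a coboundary as soon as
   the equations of order n hold, and it is a cocycle because the differential
   squares to zero; in degree 2 this is an explicit combination of instances of
   the Hom-Jacobi identity.  For n = 1 the right-hand sides are empty sums, and
   the order 1 part of an equivalence S says that the two first order terms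
   differ by the differential of (S_1, 0). *)

Require Import Defs.
From mathcomp Require Import all_boot all_order all_algebra zify.
From mathcomp Require Import boolp classical_sets functions.

Set Implicit Arguments.
Unset Strict Implicit.
Unset Printing Implicit Defensive.

Import GRing.Theory.
Local Open Scope ring_scope.

(** * Equalities in abelian groups, decided by reflection *)

Inductive zexpr := ZVar of nat | ZZero | ZAdd of zexpr & zexpr | ZOpp of zexpr.

Fixpoint zcoef (e : zexpr) (n : nat) : int :=
  match e with
  | ZVar m => (m == n)%:R
  | ZZero => 0
  | ZAdd e1 e2 => zcoef e1 n + zcoef e2 n
  | ZOpp e => - zcoef e n
  end.

Section Zexpr.
Variable V : zmodType.

Fixpoint zeval (env : seq V) (e : zexpr) : V :=
  match e with
  | ZVar n => env`_n
  | ZZero => 0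
  | ZAdd e1 e2 => zeval env e1 + zeval env e2
  | ZOpp e => - zeval env e
  end.

Lemma zevalE env e :
  zeval env e = \sum_(i < size env) env`_i *~ zcoef e i.
Proof.
elim: e => /= [n||e1 IH1 e2 IH2|e IH].
- case: (ltnP n (size env)) => ltn; last first.
    rewrite nth_default // big1 // => i _.
    by rewrite gtn_eqF // (leq_trans _ ltn).
  rewrite (bigD1 (Ordinal ltn)) //= eqxx big1 ?addr0 // => i.
  by rewrite -val_eqE eq_sym /= => /negPf->.
- by rewrite big1.
- by rewrite IH1 IH2 -big_split; apply: eq_bigr => i _; rewrite mulrzDr.
- by rewrite IH -sumrN; apply: eq_bigr => i _; rewrite mulrNz.
Qed.

(** By [zevalE] a value depends only on the integer coefficients of the atoms in [env], and these
    can be compared by computation. *)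
Lemma zeval_eq env e1 e2 :
    all (fun i => zcoef e1 i == zcoef e2 i) (iota 0 (size env)) ->
  zeval env e1 = zeval env e2.
Proof.
move/allP => eq12; rewrite !zevalE; apply: eq_bigr => i _.
by congr (_ *~ _); apply/eqP/eq12; rewrite mem_iota /=.
Qed.

End Zexpr.

(* Atoms are compared up to conversion, since the structures in the bodies of
   equal big operators may be inferred along different paths. *)
Ltac zatom_index env x :=
  match env with
  | ?y :: _ => let _ := match goal with _ => unify x y end in constr:(0%N)
  | _ :: ?env' => let n := zatom_index env' x in constr:(n.+1)
  end.

Ltac zatoms env x :=
  lazymatch x with
  | 0 => env
  | ?a + ?b => let env' := zatoms env a in zatoms env' b
  | - ?a => zatoms env a
  | _ => match env with
         | _ => let n := zatom_index env x in env
         | _ => constr:(x :: env)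
         end
  end.

Ltac zreify env x :=
  lazymatch x with
  | 0 => constr:(ZZero)
  | ?a + ?b =>
      let e := zreify env a in let e' := zreify env b in constr:(ZAdd e e')
  | - ?a => let e := zreify env a in constr:(ZOpp e)
  | _ => let n := zatom_index env x in constr:(ZVar n)
  end.

(** Only zero, sums and opposites are interpreted. A bracket or a scaled vector is an atom, so
    linearity and skew-symmetry have to be applied beforehand. *)
Ltac zmodule :=
  lazymatch goal with
  | |- @eq ?V ?x ?y =>
      let env0 := zatoms (@nil V) x in
      let env := zatoms env0 y in
      let e1 := zreify env x in
      let e2 := zreify env y in
      refine (@zeval_eq _ env e1 e2 _); vm_compute; reflexivity
  end.

(** * The differential in low degrees on explicit tuples *)

Section Tuples.
Variables (K : fieldType) (g : lmodType K).
Implicit Types (s : seq g) (f : g -> g -> g) (h : g -> g).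

(** Reading a tuple off a sequence with default [0] turns omission, prepending and mapping into list
    operations that compute. *)
Definition args n s : 'I_n -> g := fun i => s`_i.

Lemma omit_args n (i : 'I_n.+1) s :
  omit i (args s) = args (take i s ++ drop i.+1 s) :> ('I_n -> g).
Proof.
apply/funext => k; rewrite /omit /args /= /bump nth_cat size_take_min.
case: (leqP i k) => ik /=.
  rewrite ltnNge (leq_trans (geq_minl _ _) ik) /= nth_drop.
  (* If [i] lies beyond the sequence, both sides read the default value. *)
  case: (leqP (size s) i) => si.
    rewrite [LHS]nth_default ?[RHS]nth_default //.
      by rewrite (leq_trans si) // addSn (leq_trans (leqnSn i)) // ltnS leq_addr.
    by rewrite (leq_trans si) // (leq_trans ik) // leq_addl.
  by rewrite add1n addSn subnKC.
rewrite add0n leq_min ik /=; case: (ltnP k (size s)) => ks.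
  by rewrite nth_take.
rewrite drop_oversize ?nth_nil ?nth_default //.
by rewrite (leq_trans ks) // ltnW // ltnW.
Qed.

Lemma fcons_args n (i : 'I_n.+1) v s : fcons i v (args s) = args (v :: s).
Proof.
apply/funext => k; rewrite /fcons /args; set o := Ordinal _.
have -> : o = ord0 by apply: val_inj.
by case: (unliftP ord0 k) => [j|] ->; rewrite /= ?lift0.
Qed.

(** Positions beyond the sequence hold [0], which [alpha] has to fix. *)
Lemma comp_args n alpha s :
  alpha 0 = 0 -> alpha \o @args n s = args (map alpha s).
Proof.
move=> a0; apply/funext => k; rewrite /args /=.
case: (ltnP k (size s)) => ks; first by rewrite (nth_map 0).
by rewrite !nth_default ?size_map.
Qed.

Lemma argsE n (x : 'I_n -> g) : x = args [seq x i | i <- enum 'I_n].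
Proof.
by apply/funext => k; rewrite /args (nth_map k) ?size_enum_ord // nth_ord_enum.
Qed.

Variables (nu : g -> g -> g) (alpha : g -> g).
Hypothesis alpha0 : alpha 0 = 0.

(** With the condition moved into the summand, both ranges are full ordinals, which [big_ord_recl]
    unrolls. *)
Lemma sum_ltn_mkcond n m (F : 'I_n -> 'I_m -> g) :
  \sum_(j < n) \sum_(i < m | (i < j)%N) F j i
  = \sum_(j < n) \sum_(i < m) if (i < j)%N then F j i else 0.
Proof. by apply: eq_bigr => j _; rewrite big_mkcond. Qed.

Local Ltac expand_sums :=
  rewrite sum_ltn_mkcond !big_ord_recl !big_ord0 /= !omit_args /= ?omit_args /=
    ?comp_args //= ?fcons_args /args /bump /= ?add1n ?add0n ?addSn ?add0n
    ?exprS expr0 ?mulr1 ?mulN1r ?opprK ?scaleN1r ?scale1r.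

Lemma d_ce_mfun1 p h a b : d_ce nu alpha p (mfun1 h) (args [:: a; b]) =
  nu (iter p alpha a) (h b) - nu (iter p alpha b) (h a) - h (nu a b).
Proof. rewrite /d_ce; expand_sums; rewrite /mfun1 /=; zmodule. Qed.

Lemma d_ce_mfun2 p f a b c : d_ce nu alpha p (mfun2 f) (args [:: a; b; c]) =
  nu (iter p alpha a) (f b c) - nu (iter p alpha b) (f a c)
  + nu (iter p alpha c) (f a b)
  - (f (nu a b) (alpha c) - f (nu a c) (alpha b) + f (nu b c) (alpha a)).
Proof. rewrite /d_ce; expand_sums; rewrite /mfun2 /=; zmodule. Qed.

Lemma d_ce_mfun3 p (f : g -> g -> g -> g) a b c d :
  d_ce nu alpha p (mfun3 f) (args [:: a; b; c; d]) =
  nu (iter p alpha a) (f b c d) - nu (iter p alpha b) (f a c d)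
  + nu (iter p alpha c) (f a b d) - nu (iter p alpha d) (f a b c)
  - (f (nu a b) (alpha c) (alpha d) - f (nu a c) (alpha b) (alpha d)
     + f (nu a d) (alpha b) (alpha c) + f (nu b c) (alpha a) (alpha d)
     - f (nu b d) (alpha a) (alpha c) + f (nu c d) (alpha a) (alpha b)).
Proof. rewrite /d_ce; expand_sums; rewrite /mfun3 /=; zmodule. Qed.

Lemma d_alpha_nu_mfun1 h a b c :
  d_alpha_nu nu alpha (mfun1 h) (args [:: a; b; c]) =
  nu (nu a b) (h c) - nu (nu a c) (h b) + nu (nu b c) (h a).
Proof. rewrite /d_alpha_nu; expand_sums; rewrite /mfun1 /=; zmodule. Qed.

Lemma d_alpha_nu_mfun2 f a b c d :
  d_alpha_nu nu alpha (mfun2 f) (args [:: a; b; c; d]) =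
  nu (nu (alpha a) (alpha b)) (f c d) - nu (nu (alpha a) (alpha c)) (f b d)
  + nu (nu (alpha a) (alpha d)) (f b c) + nu (nu (alpha b) (alpha c)) (f a d)
  - nu (nu (alpha b) (alpha d)) (f a c) + nu (nu (alpha c) (alpha d)) (f a b).
Proof. rewrite /d_alpha_nu; expand_sums; rewrite /mfun2 /=; zmodule. Qed.

End Tuples.

(** * Consequences of linearity for unbundled maps *)

Section LinearMap.
Variables (K : fieldType) (U V : lmodType K) (f : U -> V).
Hypothesis f_linear : linear f.

Lemma linear_map0 : f 0 = 0.
Proof. by have := f_linear (-1) 0 0; rewrite scaler0 addr0 scaleN1r addNr. Qed.

Lemma linear_mapZ a x : f (a *: x) = a *: f x.
Proof. by have := f_linear a x 0; rewrite linear_map0 !addr0. Qed.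

Lemma linear_mapD x y : f (x + y) = f x + f y.
Proof. by have := f_linear 1 x y; rewrite !scale1r. Qed.

Lemma linear_mapN x : f (- x) = - f x.
Proof. by rewrite -scaleN1r linear_mapZ scaleN1r. Qed.

End LinearMap.

(** * The differential squares to zero in degree 2 *)

Section SquareZero.
Variables (K : fieldType) (g : lmodType K).
Variables (nu : g -> g -> g) (alpha : g -> g) (nu_alpha : hom_lie nu alpha).
Variables (phi : g -> g -> g) (psi : g -> g).
Hypothesis phi_linearl : forall y, linear (phi^~ y).
Hypothesis phi_linearr : forall x, linear (phi x).
Hypothesis phi_skew : forall x y, phi x y = - phi y x.
Hypothesis psi_linear : linear psi.

Let nu_skew : forall x y, nu x y = - nu y x.
Proof. exact: hom_lie_skew nu_alpha. Qed.

Let nuDl x y z : nu (x + y) z = nu x z + nu y z.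
Proof. exact: (linear_mapD (hom_lie_linearl nu_alpha z)). Qed.

Let nuDr x y z : nu x (y + z) = nu x y + nu x z.
Proof. exact: (linear_mapD (hom_lie_linearr nu_alpha x)). Qed.

Let nuNl x y : nu (- x) y = - nu x y.
Proof. exact: (linear_mapN (hom_lie_linearl nu_alpha y)). Qed.

Let nuNr x y : nu x (- y) = - nu x y.
Proof. exact: (linear_mapN (hom_lie_linearr nu_alpha x)). Qed.

Let phiDl x y z : phi (x + y) z = phi x z + phi y z.
Proof. exact: (linear_mapD (phi_linearl z)). Qed.

Let phiDr x y z : phi x (y + z) = phi x y + phi x z.
Proof. exact: (linear_mapD (phi_linearr x)). Qed.

Let phiNl x y : phi (- x) y = - phi x y.
Proof. exact: (linear_mapN (phi_linearl y)). Qed.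

Let phiNr x y : phi x (- y) = - phi x y.
Proof. exact: (linear_mapN (phi_linearr x)). Qed.

Let alphaD x y : alpha (x + y) = alpha x + alpha y.
Proof. exact: (linear_mapD (hom_lie_linear nu_alpha)). Qed.

Let alphaN x : alpha (- x) = - alpha x.
Proof. exact: (linear_mapN (hom_lie_linear nu_alpha)). Qed.

Let alpha0 : alpha 0 = 0.
Proof. exact: (linear_map0 (hom_lie_linear nu_alpha)). Qed.

Let psiD x y : psi (x + y) = psi x + psi y.
Proof. exact: (linear_mapD psi_linear). Qed.

Let psiN x : psi (- x) = - psi x.
Proof. exact: (linear_mapN psi_linear). Qed.

Let linE := (nuDl, nuDr, nuNl, nuNr, phiDl, phiDr, phiNl, phiNr,
  alphaD, alphaN, psiD, psiN, hom_lie_mult nu_alpha).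

(** The first-order variation of the cyclic sum of [nu (alpha a) (nu b c)] when [nu] and [alpha]
    vary by [phi] and [psi]. The three lines vary the inner bracket, the outer bracket and
    [alpha]. *)
Definition d2_nu a b c :=
  nu (alpha a) (phi b c) - nu (alpha b) (phi a c) + nu (alpha c) (phi a b)
  + (phi (alpha a) (nu b c) - phi (alpha b) (nu a c) + phi (alpha c) (nu a b))
  + (nu (psi a) (nu b c) - nu (psi b) (nu a c) + nu (psi c) (nu a b)).

(** The first-order variation of [alpha (nu a b) - nu (alpha a) (alpha b)]. *)
Definition d2_alpha a b :=
  alpha (phi a b) + psi (nu a b)
  - (phi (alpha a) (alpha b) + nu (psi a) (alpha b) + nu (alpha a) (psi b)).

Lemma differential2E : differential (n := 2) nu alpha (mfun2 phi, mfun1 psi)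
  = (mfun3 d2_nu, mfun2 d2_alpha).
Proof.
rewrite /= /d_nu_nu /d_alpha_alpha; congr pair; apply/funext => x;
  rewrite [x]argsE !enum_ordSl enum_ord0 /= !fctE.
  rewrite d_ce_mfun2 // d_alpha_nu_mfun1 // /mfun3 /args /d2_nu /=.
  by rewrite !(phi_skew (nu _ _)) !(nu_skew (nu _ _)); zmodule.
rewrite d_ce_mfun1 // /d_nu_alpha /mfun2 /args /d2_alpha /=.
by rewrite !(nu_skew (psi _)); zmodule.
Qed.

Let jac a b c := nu (alpha a) (nu b c) - nu (alpha b) (nu a c)
  + nu (alpha c) (nu a b).

Let jac0 a b c : jac a b c = 0.
Proof.
(* Moving the inner brackets to the second slot changes the sign, so [jac] is the opposite of the
   Hom-Jacobi sum. *)
rewrite /jac -[RHS]oppr0 -(hom_lie_jacobi nu_alpha a b c) /cyc.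
by rewrite !(nu_skew (nu _ _)) (nu_skew c a) nuNr; zmodule.
Qed.

(** The terms in [phi] cancel by multiplicativity and skew-symmetry. Those in [psi] form Hom-Jacobi
    instances with one entry under [psi], together with [psi] of one instance. *)
Lemma differential_d2_alpha a b c :
  alpha (d2_nu a b c) - d2_nu (alpha a) (alpha b) (alpha c)
  - (nu (alpha (alpha a)) (d2_alpha b c) - nu (alpha (alpha b)) (d2_alpha a c)
     + nu (alpha (alpha c)) (d2_alpha a b)
     - (d2_alpha (nu a b) (alpha c) - d2_alpha (nu a c) (alpha b)
        + d2_alpha (nu b c) (alpha a))) = 0.
Proof.
have H : jac (alpha a) (alpha b) (psi c) - jac (alpha a) (alpha c) (psi b)
   + jac (alpha b) (alpha c) (psi a) - psi (jac a b c) = 0.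
  by rewrite !jac0 (linear_map0 psi_linear); zmodule.
rewrite -[RHS]H /jac /d2_nu /d2_alpha !linE.
(* Skew-symmetry is used to orient the brackets, so that terms equal up to sign become the same
   atom. *)
rewrite !(nu_skew (psi (nu _ _))) !(phi_skew (nu _ _)) !(nu_skew (alpha (psi _))).
rewrite !(nu_skew (psi (alpha _))) !(nu_skew (nu a b)) !(nu_skew (nu a c))
  !(nu_skew (nu b c)).
rewrite !(nu_skew (psi _) (alpha _)) !linE.
zmodule.
Qed.

(** The terms in [phi] come from six Hom-Jacobi instances with an entry under [phi] and four
    instances inside [phi]. Those in [psi] come from twelve instances with an entry under [psi] and
    a bracket as another entry, and eight bracketed with [psi (alpha _)] or [alpha (psi _)]. *)
Lemma differential_d2_nu a b c d :
  nu (alpha (alpha a)) (d2_nu b c d) - nu (alpha (alpha b)) (d2_nu a c d)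
  + nu (alpha (alpha c)) (d2_nu a b d) - nu (alpha (alpha d)) (d2_nu a b c)
  - (d2_nu (nu a b) (alpha c) (alpha d) - d2_nu (nu a c) (alpha b) (alpha d)
     + d2_nu (nu a d) (alpha b) (alpha c) + d2_nu (nu b c) (alpha a) (alpha d)
     - d2_nu (nu b d) (alpha a) (alpha c) + d2_nu (nu c d) (alpha a) (alpha b))
  - (nu (nu (alpha a) (alpha b)) (d2_alpha c d)
     - nu (nu (alpha a) (alpha c)) (d2_alpha b d)
     + nu (nu (alpha a) (alpha d)) (d2_alpha b c)
     + nu (nu (alpha b) (alpha c)) (d2_alpha a d)
     - nu (nu (alpha b) (alpha d)) (d2_alpha a c)
     + nu (nu (alpha c) (alpha d)) (d2_alpha a b)) = 0.
Proof.
have H : jac (alpha a) (alpha b) (phi c d) - jac (alpha a) (alpha c) (phi b d)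
    + jac (alpha a) (alpha d) (phi b c) + jac (alpha b) (alpha c) (phi a d)
    - jac (alpha b) (alpha d) (phi a c) + jac (alpha c) (alpha d) (phi a b)
  + (jac (alpha a) (psi b) (nu c d) - jac (alpha b) (psi a) (nu c d)
    - jac (alpha a) (psi c) (nu b d) + jac (alpha c) (psi a) (nu b d)
    + jac (alpha a) (psi d) (nu b c) - jac (alpha d) (psi a) (nu b c)
    + jac (alpha b) (psi c) (nu a d) - jac (alpha c) (psi b) (nu a d)
    - jac (alpha b) (psi d) (nu a c) + jac (alpha d) (psi b) (nu a c)
    + jac (alpha c) (psi d) (nu a b) - jac (alpha d) (psi c) (nu a b))
  + (phi (alpha (alpha d)) (jac a b c) - phi (alpha (alpha c)) (jac a b d)
    + phi (alpha (alpha b)) (jac a c d) - phi (alpha (alpha a)) (jac b c d))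
  + (nu (psi (alpha d)) (jac a b c) - nu (psi (alpha c)) (jac a b d)
    + nu (psi (alpha b)) (jac a c d) - nu (psi (alpha a)) (jac b c d))
  + (nu (alpha (psi d)) (jac a b c) - nu (alpha (psi c)) (jac a b d)
    + nu (alpha (psi b)) (jac a c d) - nu (alpha (psi a)) (jac b c d)) = 0.
  by rewrite !jac0 ![nu _ 0](linear_map0 (hom_lie_linearr nu_alpha _))
    ![phi _ 0](linear_map0 (phi_linearr _)); zmodule.
rewrite -[RHS]H /jac /d2_nu /d2_alpha !linE.
rewrite !(nu_skew (psi (nu _ _))) !(nu_skew (alpha (phi _ _))).
rewrite !(nu_skew _ (psi a)) !(nu_skew _ (psi b)) !(nu_skew _ (psi c))
  !(nu_skew _ (psi d)).
rewrite !(phi_skew (nu a _)) !(phi_skew (nu b _)) !(phi_skew (nu c _)).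
rewrite !(nu_skew (nu a _)) !(nu_skew (nu b _)) !(nu_skew (nu c _)).
rewrite !(phi_skew (nu (alpha b) (alpha c))) !(phi_skew (nu (alpha b) (alpha d)))
  !(phi_skew (nu (alpha c) (alpha d))).
rewrite !linE.
zmodule.
Qed.

Lemma differential_squared2 :
  differential (n := 3) nu alpha (mfun3 d2_nu, mfun2 d2_alpha) = 0.
Proof.
rewrite /= /d_nu_nu /d_alpha_alpha; congr pair; apply/funext => x;
  rewrite [x]argsE !enum_ordSl enum_ord0 /= !fctE.
  by rewrite d_ce_mfun3 // d_alpha_nu_mfun2 // differential_d2_nu.
rewrite d_ce_mfun2 // /d_nu_alpha /mfun3 /args /=.
exact: differential_d2_alpha.
Qed.

Lemma d2_nu_swap12 a b c : d2_nu a b c = - d2_nu b a c.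
Proof.
rewrite /d2_nu (phi_skew b a) (nu_skew b a) !linE; zmodule.
Qed.

Lemma d2_nu_swap23 a b c : d2_nu a b c = - d2_nu a c b.
Proof.
rewrite /d2_nu (phi_skew c b) (nu_skew c b) !linE; zmodule.
Qed.

Lemma d2_alpha_skew a b : d2_alpha a b = - d2_alpha b a.
Proof.
rewrite /d2_alpha (phi_skew b a) (nu_skew b a) (phi_skew (alpha b)).
rewrite (nu_skew (psi b)) (nu_skew (alpha b)) !linE; zmodule.
Qed.

Let linZE := (linE, linear_mapZ (hom_lie_linear nu_alpha),
  fun z => linear_mapZ (hom_lie_linearl nu_alpha z),
  fun z => linear_mapZ (hom_lie_linearr nu_alpha z),
  fun z => linear_mapZ (phi_linearl z), fun z => linear_mapZ (phi_linearr z),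
  linear_mapZ psi_linear, scalerDr, scalerN).

Lemma d2_nu_linear b c : linear (fun a => d2_nu a b c).
Proof. move=> k u v; rewrite /d2_nu !linZE /=; zmodule. Qed.

Lemma d2_alpha_linear b : linear (d2_alpha^~ b).
Proof. move=> k u v; rewrite /d2_alpha !linZE; zmodule. Qed.

End SquareZero.

(** * From skew-symmetric to alternating maps *)

Section Alternating.
Variables (K : fieldType) (charK : [pchar K] =i pred0) (g : lmodType K).

(** Characteristic zero enters here: 2 is invertible, so a skew-symmetric map vanishes on repeated
    arguments. *)
Lemma eq_opp_eq0 (u : g) : u = - u -> u = 0.
Proof.
move/eqP; rewrite -subr_eq0 opprK -mulr2n -scaler_nat scaler_eq0.
by have /pcharf0P-> := charK => /eqP.
Qed.

Lemma alternating_mfun0 : alternating (0 : mfun g 0).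
Proof. by split=> // x []. Qed.

Lemma alternating_mfun1 (f : g -> g) : linear f -> alternating (mfun1 f).
Proof.
move=> lf; split=> // [x i|x i j]; last by rewrite !ord1 eqxx.
by rewrite ord1 => k u v; rewrite /mfun1 !dfwith_in lf.
Qed.

Lemma alternating_mfun2 (f : g -> g -> g) :
    (forall y, linear (f^~ y)) -> (forall x y, f x y = - f y x) ->
  alternating (mfun2 f).
Proof.
move=> lf skew; have ord2 (i : 'I_2) : i = 0 \/ i = 1.
  by case: i => [[|[|//]] ?]; [left|right]; apply: val_inj.
split=> // [x i|x i j].
  move=> k u v; rewrite /mfun2.
  case: (ord2 i) => ->; rewrite !dfwith_in ?dfwith_out //; first by rewrite lf.
  by rewrite !(skew (x 0)) lf scalerN opprD.
rewrite /mfun2; case: (ord2 i) (ord2 j) => -> [] -> //= _ xe; apply: eq_opp_eq0;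
  by rewrite -xe -skew.
Qed.

(** The two adjacent transpositions generate all permutations, so linearity in the first argument
    passes to the others. A cyclic rotation is even and makes equal outer arguments adjacent. *)
Lemma alternating_mfun3 (f : g -> g -> g -> g) :
    (forall y z, linear (fun x => f x y z)) ->
    (forall x y z, f x y z = - f y x z) -> (forall x y z, f x y z = - f x z y) ->
  alternating (mfun3 f).
Proof.
move=> lf skew12 skew23; have ord3 (i : 'I_3) : [\/ i = 0, i = 1 | i = 2].
  by case: i => [[|[|[|//]]] ?];
    [apply: Or31|apply: Or32|apply: Or33]; apply: val_inj.
have rot x y z : f x y z = f z x y by rewrite skew23 skew12 opprK.
split=> // [x i|x i j].
  move=> k u v; rewrite /mfun3.
  case: (ord3 i) => ->; rewrite !dfwith_in ?dfwith_out //; first by rewrite lf.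
    by rewrite !(skew12 (x 0)) lf scalerN opprD.
  by rewrite !(rot (x 0)) lf.
have eq12 y z : f y y z = 0 by apply: eq_opp_eq0; rewrite -skew12.
have eq23 y z : f y z z = 0 by apply: eq_opp_eq0; rewrite -skew23.
by rewrite /mfun3; case: (ord3 i) (ord3 j) => -> [] -> //= _ xe;
  rewrite xe ?eq12 ?eq23 // rot ?eq12.
Qed.

End Alternating.

(** * Sums over index triples with a fixed total *)

Section Sum3.
Variable V : zmodType.
Implicit Types F G : nat -> nat -> nat -> V.

Lemma sum3D N n F G :
  sum3 N n (fun i j k => F i j k + G i j k) = sum3 N n F + sum3 N n G.
Proof.
rewrite /sum3 -big_split; apply: eq_bigr => i _.
by rewrite -big_split; apply: eq_bigr => j _; rewrite -big_split.
Qed.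

Lemma sum3N N n F : sum3 N n (fun i j k => - F i j k) = - sum3 N n F.
Proof.
rewrite /sum3 -sumrN; apply: eq_bigr => i _.
by rewrite -sumrN; apply: eq_bigr => j _; rewrite -sumrN.
Qed.

Lemma eq_sum3 N n F G :
  (forall i j k, F i j k = G i j k) -> sum3 N n F = sum3 N n G.
Proof. by move=> FG; do 3!apply: eq_bigr => ? _. Qed.

Lemma sum3_cyc (A : Type) N n (F : nat -> nat -> nat -> A -> A -> A -> V) x y z :
  sum3 N n (fun i j k => cyc (F i j k) x y z)
  = cyc (fun x y z => sum3 N n (fun i j k => F i j k x y z)) x y z.
Proof. by rewrite /cyc !sum3D. Qed.

Lemma sum3_swap23 N n F : sum3 N n F = sum3 N n (fun i j k => F i k j).
Proof.
apply: eq_bigr => i _; rewrite [RHS](exchange_big_dep predT) //=.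
by apply: eq_bigr => j _; apply: eq_bigl => k; rewrite addnAC.
Qed.

Lemma sum3_1 F : sum3 1 1 F = 0.
Proof. by rewrite /sum3 !big_ord1 big_pred0 // => k; rewrite (ord1 k). Qed.

(** A triple of total [n] with an index equal to [n] has its other indices zero. As [n] is positive,
    the three such triples are distinct. *)
Lemma sum3_recr n F : (0 < n)%N ->
  sum3 n.+1 n F = F n 0%N 0%N + F 0%N n 0%N + F 0%N 0%N n + sum3 n n F.
Proof.
move=> n_gt0; have sum0 m (G : 'I_m -> V) (i0 : 'I_m) :
    i0 = 0%N :> nat -> (forall i : 'I_m, (0 < i)%N -> G i = 0) ->
    \sum_(i < m) G i = G i0.
  move=> i0E G0; rewrite (bigD1 i0) //= big1 ?addr0 // => i i_neq0.
  by apply: G0; rewrite lt0n -i0E.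
have lift_sum i j (G : nat -> V) :
    \sum_(k < n.+1 | (i + j + k == n)%N) G k
    = \sum_(k < n | (i + j + k == n)%N) G k
      + if (i + j + n == n)%N then G n else 0.
  by rewrite big_mkcond big_ord_recr -big_mkcond.
have Fn00 : \sum_(j < n.+1) \sum_(k < n.+1 | (n + j + k == n)%N) F n j k
    = F n 0%N 0%N.
  rewrite (sum0 _ _ ord0) // => [|j j_gt0].
    by rewrite (big_pred1 ord0) // => k; rewrite /= -val_eqE /=; lia.
  by rewrite big_pred0 // => k; lia.
have F0n0 : \sum_(i < n) \sum_(k < n.+1 | (i + n + k == n)%N) F i n k
    = F 0%N n 0%N.
  rewrite (sum0 _ _ (Ordinal n_gt0)) // => [|i i_gt0].
    by rewrite (big_pred1 ord0) // => k; rewrite /= -val_eqE /=; lia.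
  by rewrite big_pred0 // => k; lia.
have F00n : \sum_(i < n) \sum_(j < n) (if (i + j + n == n)%N then F i j n else 0)
    = F 0%N 0%N n.
  rewrite (sum0 _ _ (Ordinal n_gt0)) // => [|i i_gt0].
    rewrite (sum0 _ _ (Ordinal n_gt0)) //= ?eqxx // => j j_gt0.
    by case: ifP => //; lia.
  by rewrite big1 // => j _; case: ifP => //; lia.
(* The value [n] is split off from the range of [i], then of [j], then of [k]. *)
rewrite [LHS]big_ord_recr /= Fn00.
under eq_bigr => i _ do rewrite big_ord_recr /=.
rewrite big_split /= F0n0.
under eq_bigr => i _.
  under eq_bigr => j _ do rewrite lift_sum.
  rewrite big_split /=; over.
by rewrite big_split /= F00n -[X in X + _ + _ + _]/(sum3 n n F); zmodule.
Qed.

End Sum3.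

(** * The deformation equations as coefficients of the Hom-Lie identities *)

Section DeformationEquations.
Variables (K : fieldType) (g : lmodType K).
Variables (nu : g -> g -> g) (alpha : g -> g).
Variables (nus : nat -> g -> g -> g) (alphas : nat -> g -> g).
Hypothesis nus_alphas : formal_coefs nu alpha nus alphas.

(** The embedding of [g] into [g[[t]]]: on constants, the coefficient of order [n] of an identity
    over [K[[t]]] is its equation of order [n]. *)
Definition fps_const (v : g) : fps g := fun n => if n == 0%N then v else 0.

Lemma series1_const (f : nat -> g -> g) v n :
  (forall i, linear (f i)) -> series1 f (fps_const v) n = f n v.
Proof.
move=> f_lin; rewrite /series1 big_ord_recr /= subnn big1 ?add0r // => i _.
by rewrite /fps_const subn_eq0 leqNgt ltn_ord /= linear_map0.
Qed.

Lemma series2_const v w n :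
  series2 nus (fps_const v) (fps_const w) n = nus n v w.
Proof.
have nus0l i x : nus i 0 x = 0.
  exact: (linear_map0 (formal_coefs_linearl nus_alphas i x)).
have nus0r i x : nus i x 0 = 0.
  exact: (linear_map0 (formal_coefs_linearr nus_alphas i x)).
case: n => [|n]; first by rewrite /series2 /sum3 !big_ord1 big_mkcond big_ord1.
rewrite /series2 sum3_recr // /fps_const /= nus0l nus0r !addr0 -[RHS]addr0.
(* Each remaining term has a vanishing coefficient at a positive [j] or [k]; with [j] and [k] both
   zero, the total would force [i] out of range. *)
congr (_ + _); apply: big1 => i _; apply: big1 => -[[|j] jn] _; last first.
  by apply: big1 => k _ /=; rewrite nus0l.
apply: big1 => -[[|k] kn] /=; last by rewrite nus0r.
by rewrite !addn0 ltn_eqF.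
Qed.

Lemma deformation_jacobi n : deformation nu alpha nus alphas ->
  jacobi_equation nus alphas n.
Proof.
move=> [_ h] x y z; rewrite sum3_cyc.
have := congr1 (fun u : fps g => u n)
  (hom_lie_jacobi h (fps_const x) (fps_const y) (fps_const z)).
rewrite /cyc !fps_addE.
have E a b d : series2 nus (series2 nus (fps_const a) (fps_const b))
      (series1 alphas (fps_const d)) n
    = - sum3 n.+1 n (fun i j k => nus i (alphas j d) (nus k a b)).
  (* The Hom-Jacobi identity has its inner bracket in the first slot and the deformation equation in
     the second. Exchanging the slots costs a sign and swaps their indices. *)
  rewrite -sum3N sum3_swap23; apply: eq_sum3 => i j k.
  rewrite series2_const series1_const; last exact: formal_coefs_linear nus_alphas.
  exact: formal_coefs_skew nus_alphas _ _ _.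
rewrite !E => /(congr1 -%R); rewrite !opprD !opprK => H.
rewrite -[RHS]oppr0 -[in RHS]H; zmodule.
Qed.

Lemma deformation_mult n : deformation nu alpha nus alphas ->
  mult_equation nus alphas n.
Proof.
move=> [_ h] x y.
have := congr1 (fun u : fps g => u n)
  (hom_lie_mult h (fps_const x) (fps_const y)).
rewrite {1}/series1 big_mkord.
under eq_bigr => i _ do rewrite series2_const.
move=> ->; apply/eqP; rewrite subr_eq0; apply/eqP/eq_sum3 => i j k.
by rewrite !series1_const; do ?exact: formal_coefs_linear nus_alphas.
Qed.

(** An identity for the defect of arbitrary coefficients, from which both directions of the
    equivalence follow by [subr_eq0]. *)
Lemma jacobi_defect n x y z : (0 < n)%N ->
  sum3 n.+1 n (fun i j k =>
    cyc (fun x y z => nus i (alphas j x) (nus k y z)) x y z)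
  = d2_nu nu alpha (nus n) (alphas n) x y z - R1 nus alphas n x y z.
Proof.
move=> n_gt0; rewrite sum3_recr // opprK; congr (_ + _).
have nusN i u v : nus i u (- v) = - nus i u v.
  exact: (linear_mapN (formal_coefs_linearr nus_alphas i u)).
rewrite /cyc /d2_nu -(formal_coefs_nu0 nus_alphas)
  -(formal_coefs_alpha0 nus_alphas).
by rewrite !(formal_coefs_skew nus_alphas _ z x) !nusN; zmodule.
Qed.

Lemma mult_defect n x y : (0 < n)%N ->
  \sum_(0 <= i < n.+1) alphas i (nus (n - i)%N x y)
    - sum3 n.+1 n (fun i j k => nus i (alphas j x) (alphas k y))
  = d2_alpha nu alpha (nus n) (alphas n) x y - R2 nus alphas n x y.
Proof.
(* The terms [i = n] and [i = 0] of the first sum are split off; they are distinct because [n] is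
   positive. *)
move=> n_gt0; rewrite sum3_recr // big_nat_recr //= big_ltn // subn0 subnn.
rewrite /d2_alpha /R2.
rewrite -(formal_coefs_nu0 nus_alphas) -(formal_coefs_alpha0 nus_alphas).
zmodule.
Qed.

Lemma deformation_equationsE n : (0 < n)%N ->
  jacobi_equation nus alphas n /\ mult_equation nus alphas n <->
  (mfun3 (d2_nu nu alpha (nus n) (alphas n)),
   mfun2 (d2_alpha nu alpha (nus n) (alphas n)))
  = (mfun3 (R1 nus alphas n), mfun2 (R2 nus alphas n)).
Proof.
move=> n_gt0; split=> [[jac mult]|[d_nu d_alpha]].
  congr pair; apply/funext => x; apply/eqP; rewrite -subr_eq0; apply/eqP.
    by rewrite -jacobi_defect.
  by rewrite -mult_defect.
split=> [x y z|x y].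
  rewrite jacobi_defect //; apply/eqP; rewrite subr_eq0; apply/eqP.
  exact: (congr1 (fun f => f (args [:: x; y; z])) d_nu).
rewrite mult_defect //; apply/eqP; rewrite subr_eq0; apply/eqP.
exact: (congr1 (fun f => f (args [:: x; y])) d_alpha).
Qed.

Lemma deformation_obstructionE n : deformation nu alpha nus alphas -> (0 < n)%N ->
  (mfun3 (d2_nu nu alpha (nus n) (alphas n)),
   mfun2 (d2_alpha nu alpha (nus n) (alphas n)))
  = (mfun3 (R1 nus alphas n), mfun2 (R2 nus alphas n)).
Proof.
move=> h n_gt0; apply/(deformation_equationsE n_gt0).
by split; [apply: deformation_jacobi | apply: deformation_mult].
Qed.

End DeformationEquations.

(** * Additivity of the differential and equality of classes *)

Section Cohomology.
Variables (K : fieldType) (g : lmodType K).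
Variables (nu : g -> g -> g) (alpha : g -> g) (nu_alpha : hom_lie nu alpha).

Lemma mfunB n (f h : mfun g n) x : (f - h) x = f x - h x.
Proof. by []. Qed.

Lemma alternatingB n (f h : mfun g n) :
  alternating f -> alternating h -> alternating (f - h).
Proof.
move=> alt_f alt_h; split=> [x i|x i j ij xE|n0].
- move=> k u v /=; rewrite !mfunB (alternating_linear alt_f)
    (alternating_linear alt_h).
  by rewrite scalerBr; zmodule.
- by rewrite !mfunB (alternating_eq0 alt_f ij xE)
    (alternating_eq0 alt_h ij xE) subr0.
- by rewrite (alternating_arity0 alt_f n0) (alternating_arity0 alt_h n0) subrr.
Qed.

Let nuB x y z : nu x (y - z) = nu x y - nu x z.
Proof.
by rewrite (linear_mapD (hom_lie_linearr nu_alpha x))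
           (linear_mapN (hom_lie_linearr nu_alpha x)).
Qed.

(** The cochain occurs only in the second slot of [nu], hence additivity on the right is what
    matters. *)
Lemma d_ceB p n : {morph @d_ce _ _ nu alpha p n : f h / f - h}.
Proof.
move=> f h; apply/funext => x; rewrite mfunB /d_ce.
under eq_bigr => i _ do rewrite mfunB nuB scalerBr.
under [X in _ - X = _]eq_bigr => j _.
  under eq_bigr => i _ do rewrite mfunB scalerBr.
  rewrite sumrB; over.
by rewrite !sumrB; zmodule.
Qed.

Lemma d_alpha_nuB n : {morph @d_alpha_nu _ _ nu alpha n : f h / f - h}.
Proof.
move=> f h; apply/funext => x; rewrite mfunB /d_alpha_nu.
rewrite -sumrB; apply: eq_bigr => j _; rewrite -sumrB; apply: eq_bigr => i _.
by rewrite mfunB nuB scalerBr.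
Qed.

Lemma d_nu_alphaB n : {morph @d_nu_alpha _ _ alpha n : f h / f - h}.
Proof.
move=> f h; apply/funext => x; rewrite mfunB /d_nu_alpha !mfunB.
rewrite (linear_mapD (hom_lie_linear nu_alpha))
  (linear_mapN (hom_lie_linear nu_alpha)).
zmodule.
Qed.

Lemma differentialB n : {morph @differential _ _ nu alpha n : c e / c - e}.
Proof.
case: n => [|n] c e; first by rewrite /= subrr.
rewrite /= /d_nu_nu /d_alpha_alpha; congr pair => /=.
  rewrite d_ceB d_alpha_nuB; apply/funext => x; rewrite !mfunB; zmodule.
by rewrite d_ceB d_nu_alphaB; apply/funext => x; rewrite !mfunB; zmodule.
Qed.

Lemma coboundariesB n (b e : cochain g n.+1) :
  coboundaries nu alpha n.+1 b -> coboundaries nu alpha n.+1 e ->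
  coboundaries nu alpha n.+1 (b - e).
Proof.
move=> [c [alt1 alt2] <-] [c' [alt1' alt2'] <-]; exists (c - c').
  by split; apply: alternatingB.
exact: differentialB.
Qed.

Lemma eq_cohomology_class n (c e : cochain g n.+1) :
    coboundaries nu alpha n.+1 (c - e) ->
  cohomology_class (n := n.+1) nu alpha c
  = cohomology_class (n := n.+1) nu alpha e.
Proof.
move=> ce; have ec : coboundaries nu alpha n.+1 (e - c).
  (* Closure under differences gives zero as [(c - e) - (c - e)], and then the opposite of
     [c - e]. *)
  have := coboundariesB (coboundariesB ce ce) ce.
  by rewrite subrr sub0r opprB.
apply/seteqP; split=> _ [b bB <-].
  exists (b - (e - c)); first exact: coboundariesB.
  by rewrite opprB addrA addrC addrA subrK addrC.
exists (b - (c - e)); first exact: coboundariesB.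
by rewrite opprB addrA addrC addrA subrK addrC.
Qed.

End Cohomology.

(** * First-order terms of equivalent deformations *)

Section Equivalence.
Variables (K : fieldType) (g : lmodType K).
Variables (nu : g -> g -> g) (alpha : g -> g) (nu_alpha : hom_lie nu alpha).
Variables (nus nus' : nat -> g -> g -> g) (alphas alphas' : nat -> g -> g).
Hypothesis coefs : formal_coefs nu alpha nus alphas.
Hypothesis coefs' : formal_coefs nu alpha nus' alphas'.

Lemma differential1_mfun1 (S : g -> g) :
  differential (n := 1) nu alpha (mfun1 S, 0)
  = (mfun2 (fun a b => nu a (S b) - nu b (S a) - S (nu a b)),
     mfun1 (fun a => alpha (S a) - S (alpha a))).
Proof.
(* Writing the zero cochain as a difference lets additivity remove its contribution. *)
rewrite /= /d_nu_nu /d_alpha_alpha -(subrr (0 : mfun g 0)).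
rewrite d_ceB // d_alpha_nuB // !subrr !subr0; congr pair; apply/funext => x.
rewrite [x]argsE !enum_ordSl enum_ord0 /=.
by rewrite d_ce_mfun1 //; exact: (linear_map0 (hom_lie_linear nu_alpha)).
Qed.

(** Since [S] carries the primed structure to the unprimed one, the primed term minus the unprimed
    one is the differential of [(S_1, 0)], with a plus sign. *)
Lemma equivalent_deformations_coboundary :
  equivalent_deformations nus alphas nus' alphas' ->
  coboundaries nu alpha 2 ((mfun2 (nus' 1%N), mfun1 (alphas' 1%N))
                           - (mfun2 (nus 1%N), mfun1 (alphas 1%N))).
Proof.
move=> [S [S0 S_lin S_nu S_alpha]].
have series1_1 (f : nat -> g -> g) u :
    series1 f u 1%N = f 0%N (u 1%N) + f 1%N (u 0%N).
  by rewrite /series1 !big_ord_recl big_ord0 addr0.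
exists (mfun1 (S 1%N), 0).
  by split; [apply: alternating_mfun1 | apply: alternating_mfun0].
rewrite differential1_mfun1; congr pair; apply/funext => x; rewrite mfunB.
  have := congr1 (fun u : fps g => u 1%N)
    (S_nu (fps_const (x 0)) (fps_const (x 1))).
  rewrite series1_1 !(series2_const coefs') S0 (formal_coefs_nu0 coefs').
  rewrite /series2 sum3_recr // sum3_1 !series1_const // S0
    (formal_coefs_nu0 coefs).
  rewrite addr0 /mfun2 => /eqP; rewrite -subr_eq0 => /eqP H.
  apply/esym/eqP; rewrite -subr_eq0 -H; apply/eqP.
  by rewrite (hom_lie_skew nu_alpha (x 1)); zmodule.
have := congr1 (fun u : fps g => u 1%N) (S_alpha (fps_const (x 0))).
rewrite (series1_1 S) (series1_1 alphas) !series1_const //;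
  try exact: formal_coefs_linear coefs'.
rewrite S0 (formal_coefs_alpha0 coefs') (formal_coefs_alpha0 coefs) /mfun1.
move=> /eqP; rewrite -subr_eq0 => /eqP H.
by apply/esym/eqP; rewrite -subr_eq0 -H; apply/eqP; zmodule.
Qed.

End Equivalence.

Theorem theorem4p3 (K : fieldType) (charK : [pchar K] =i pred0)
    (g : lmodType K) (nu : g -> g -> g) (alpha : g -> g)
    (hg : hom_lie nu alpha)
    (nus : nat -> g -> g -> g) (alphas : nat -> g -> g)
    (hcoefs : formal_coefs nu alpha nus alphas) :
  (deformation nu alpha nus alphas ->
     cocycles nu alpha 2 (mfun2 (nus 1%N), mfun1 (alphas 1%N))
     /\ forall (nus' : nat -> g -> g -> g) (alphas' : nat -> g -> g),
          deformation nu alpha nus' alphas' ->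
          equivalent_deformations nus alphas nus' alphas' ->
          cohomology_class (n := 2) nu alpha
            (mfun2 (nus' 1%N), mfun1 (alphas' 1%N))
          = cohomology_class (n := 2) nu alpha
            (mfun2 (nus 1%N), mfun1 (alphas 1%N)))
  /\ (forall n : nat, (1 <= n)%N ->
       (jacobi_equation nus alphas n /\ mult_equation nus alphas n
        <-> differential (n := 2) nu alpha (mfun2 (nus n), mfun1 (alphas n))
            = (mfun3 (R1 nus alphas n), mfun2 (R2 nus alphas n)))
       /\ (deformation nu alpha nus alphas ->
             cocycles nu alpha 3
               (mfun3 (R1 nus alphas n), mfun2 (R2 nus alphas n)))).
Proof.
have differential_nus n :
    differential (n := 2) nu alpha (mfun2 (nus n), mfun1 (alphas n))
    = (mfun3 (d2_nu nu alpha (nus n) (alphas n)),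
       mfun2 (d2_alpha nu alpha (nus n) (alphas n))).
  exact: (differential2E hg _ (formal_coefs_skew hcoefs n)).
split=> [h|n n_gt0].
  split; last first.
    move=> nus' alphas' [hcoefs' _] equiv; apply: (eq_cohomology_class hg).
    exact: (equivalent_deformations_coboundary hg hcoefs hcoefs').
  split.
    split; last by apply: alternating_mfun1; exact: formal_coefs_linear hcoefs _.
    apply: (alternating_mfun2 charK); first exact: formal_coefs_linearl hcoefs _.
    exact: formal_coefs_skew hcoefs _.
  rewrite differential_nus (deformation_obstructionE hcoefs h) //.
  congr pair; apply/funext => x; first by rewrite /mfun3 /R1 sum3_1 oppr0.
  by rewrite /mfun2 /R2 sum3_1 big_geq // oppr0 addr0.
rewrite differential_nus; split; first exact: deformation_equationsE.
(* With [R1] and [R2] replaced by [d2_nu] and [d2_alpha], closedness is the vanishing of the squared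
   differential, and alternation is read off the explicit formulas. *)
move=> h; rewrite -(deformation_obstructionE hcoefs h) //.
have nus_l := formal_coefs_linearl hcoefs n.
have nus_r := formal_coefs_linearr hcoefs n.
have nus_skew := formal_coefs_skew hcoefs n.
have alphas_lin := formal_coefs_linear hcoefs n.
split; last exact: differential_squared2.
split.
  apply: (alternating_mfun3 charK); last exact: d2_nu_swap23.
    exact: d2_nu_linear.
  exact: d2_nu_swap12.
apply: (alternating_mfun2 charK); first exact: d2_alpha_linear.
exact: d2_alpha_skew.
Qed.
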